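(* Let $C$ be a Reedy category. The fully faithful functor $\mathrm{Down}(C)\hookrightarrow\mathrm{Down}_*(C)$ induced by the inclusion $\int N^{--,+}_+(C)\subseteq\int N^{-,+}(C)$ is an equivalence of categories.
   Context: A Reedy category $(C,C_-,C_+)$: wide subcategories with unique factorization of every morphism as ($C_-$ then $C_+$), membership in $C_\pm$ decidable, and the relation ($x<'y$ iff non-identity $x\to y$ in $C_+$ or non-identity $y\to x$ in $C_-$) well-founded. $\Delta$: finite ordinals $[n]$ and order-preserving maps. $\int N^{-,+}(C)$: objects $([n],X)$ with $X\colon[n]\to C$ a functor sending all morphisms into $C_-$; morphisms $([m],X)\to([n],Y)$ are $(\alpha,\theta)$ with $\alpha\colon[m]\to[n]$ in $\Delta$ and $\theta\colon X\Rightarrow Y\circ\alpha$ with all components in $C_+$; composition $(\beta,\varphi)\circ(\alpha,\theta)=(\beta\alpha,(\varphi\alpha)\circ\theta)$. $\int N^{--,+}_+(C)$: the full subcategory on objects whose $X$ reflects identities. Order on hom-sets: $(\alpha,\theta)\le(\alpha',\theta')$ iff $\alpha\le\alpha'$ pointwise and $\theta'_i=Y(\alpha(i)\le\alpha'(i))\circ\theta_i$ for all $i$ (compatible with composition). $\mathrm{Down}_*(C)$ and $\mathrm{Down}(C)$ are obtained from $\int N^{-,+}(C)$ and $\int N^{--,+}_+(C)$ by quotienting each hom-set by the equivalence relation generated by $\le$. *)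

(* Defs.v *)
From mathcomp Require Import all_boot.
From Stdlib Require Import Relation_Definitions Relation_Operators.

Set Implicit Arguments.
Unset Strict Implicit.
Unset Printing Implicit Defensive.

Record Category := {
  Ob :> Type;
  Hom : Ob -> Ob -> Type;
  idc : forall a, Hom a a;
  cmp : forall a b c, Hom b c -> Hom a b -> Hom a c;
  cmp_id_l : forall a b (f : Hom a b), cmp (idc b) f = f;
  cmp_id_r : forall a b (f : Hom a b), cmp f (idc a) = f;
  cmp_assoc : forall a b c d (f : Hom a b) (g : Hom b c) (h : Hom c d),
      cmp h (cmp g f) = cmp (cmp h g) f
}.
Arguments Hom : clear implicits.
Arguments idc {C} a : rename.
Arguments cmp {C a b c} _ _ : rename.

Definition is_id (C : Category) (a b : C) (f : Hom C a b) : Prop :=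
  exists e : a = b, eq_rect a (Hom C a) (idc a) b e = f.

Definition reedy_lt (C : Category)
    (mi pl : forall a b : C, Hom C a b -> bool) (x y : C) : Prop :=
  (exists f : Hom C x y, pl x y f /\ ~ is_id f) \/
  (exists g : Hom C y x, mi y x g /\ ~ is_id g).

Record Reedy (C : Category) := {
  minus : forall a b : C, Hom C a b -> bool;
  plus : forall a b : C, Hom C a b -> bool;
  minus_id : forall a, minus (idc a);
  plus_id : forall a, plus (idc a);
  minus_cmp : forall a b c (f : Hom C a b) (g : Hom C b c),
      minus f -> minus g -> minus (cmp g f);
  plus_cmp : forall a b c (f : Hom C a b) (g : Hom C b c),
      plus f -> plus g -> plus (cmp g f);
  fact_exists : forall a b (f : Hom C a b),
      exists (c : C) (g : Hom C a c) (h : Hom C c b),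
        [/\ minus g, plus h & cmp h g = f];
  fact_unique : forall a b (c c' : C) (g : Hom C a c) (h : Hom C c b)
      (g' : Hom C a c') (h' : Hom C c' b),
      minus g -> plus h -> minus g' -> plus h' -> cmp h g = cmp h' g' ->
      existT (fun c => (Hom C a c * Hom C c b)%type) c (g, h) =
      existT (fun c => (Hom C a c * Hom C c b)%type) c' (g', h');
  reedy_wf : well_founded (reedy_lt minus plus)
}.
Arguments minus {C} R {a b} f : rename.
Arguments plus {C} R {a b} f : rename.

Record CatData := {
  cob :> Type;
  chom : cob -> cob -> Type;
  cheq : forall a b, relation (chom a b);
  cid : forall a, chom a a;
  ccomp : forall a b c, chom b c -> chom a b -> chom a c
}.
Arguments chom : clear implicits.
Arguments cheq {C a b} _ _ : rename.
Arguments cid {C} a : rename.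
Arguments ccomp {C a b c} _ _ : rename.

Record Functor (C D : CatData) := {
  fo :> C -> D;
  fm : forall a b, chom C a b -> chom D (fo a) (fo b);
  fm_proper : forall a b (f g : chom C a b), cheq f g -> cheq (fm f) (fm g);
  fm_id : forall a, cheq (fm (cid a)) (cid (fo a));
  fm_comp : forall a b c (f : chom C a b) (g : chom C b c),
      cheq (fm (ccomp g f)) (ccomp (fm g) (fm f))
}.
Arguments fm {C D} F {a b} f : rename.

Definition is_equivalence (C D : CatData) (F : Functor C D) : Prop :=
  exists (G : Functor D C)
         (eta : forall a : C, chom C a (G (F a)))
         (etai : forall a : C, chom C (G (F a)) a)
         (eps : forall d : D, chom D (F (G d)) d)
         (epsi : forall d : D, chom D d (F (G d))),
    [/\ forall a, cheq (ccomp (etai a) (eta a)) (cid a),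
        forall a, cheq (ccomp (eta a) (etai a)) (cid (G (F a)))
      & forall a b (f : chom C a b),
          cheq (ccomp (eta b) f) (ccomp (fm G (fm F f)) (eta a))] /\
    [/\ forall d, cheq (ccomp (epsi d) (eps d)) (cid (F (G d))),
        forall d, cheq (ccomp (eps d) (epsi d)) (cid d)
      & forall d e (g : chom D d e),
          cheq (ccomp (eps e) (fm F (fm G g))) (ccomp g (eps d))].

Section IntN.
Variables (C : Category) (R : Reedy C).

(* an object ([n], X): X : [n] -> C a functor with all morphisms in C_- ;
   [n] = {0,...,n} as the poset 'I_n.+1 *)
Record NObj := {
  len : nat;
  X : 'I_len.+1 -> C;
  Xm : forall i j : 'I_len.+1, i <= j -> Hom C (X i) (X j);
  Xm_id : forall (i : 'I_len.+1) (h : i <= i), Xm h = idc (X i);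
  Xm_comp : forall i j k : 'I_len.+1, forall (h1 : i <= j) (h2 : j <= k) (h3 : i <= k),
      Xm h3 = cmp (Xm h2) (Xm h1);
  Xm_minus : forall i j : 'I_len.+1, forall (h : i <= j), minus R (Xm h)
}.

Arguments X : clear implicits.

Record NHom (A B : NObj) := {
  al : 'I_(len A).+1 -> 'I_(len B).+1;
  al_mono : forall i j : 'I_(len A).+1, i <= j -> al i <= al j;
  th : forall i, Hom C (X A i) (X B (al i));
  th_plus : forall i, plus R (th i);
  th_nat : forall i j : 'I_(len A).+1, forall (h : i <= j),
      cmp (Xm (al_mono h)) (th i) = cmp (th j) (Xm h)
}.

Lemma nid_nat (A : NObj) (i j : 'I_(len A).+1) (h : i <= j) :
  cmp (Xm (n := A) h) (idc (X A i)) = cmp (idc (X A j)) (Xm h).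
Proof. by rewrite cmp_id_l cmp_id_r. Qed.

Definition nid (A : NObj) : NHom A A :=
  @Build_NHom A A (fun i => i) (fun i j h => h) (fun i => idc (X A i))
    (fun i => plus_id R (X A i)) (@nid_nat A).

Lemma ncomp_nat (A B D : NObj) (g : NHom B D) (f : NHom A B) (i j : 'I_(len A).+1) (h : i <= j) :
  cmp (Xm (al_mono g (al_mono f h))) (cmp (th g (al f i)) (th f i)) =
  cmp (cmp (th g (al f j)) (th f j)) (Xm h).
Proof.
by rewrite cmp_assoc th_nat -cmp_assoc th_nat cmp_assoc.
Qed.

Definition ncomp (A B D : NObj) (g : NHom B D) (f : NHom A B) : NHom A D :=
  @Build_NHom A D (fun i => al g (al f i))
    (fun i j h => al_mono g (al_mono f h))
    (fun i => cmp (th g (al f i)) (th f i))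
    (fun i => plus_cmp (th_plus f i) (th_plus g (al f i)))
    (@ncomp_nat A B D g f).

Definition nle (A B : NObj) (f f' : NHom A B) : Prop :=
  (forall i, al f i <= al f' i) /\
  (forall i (h : al f i <= al f' i), th f' i = cmp (Xm h) (th f i)).

Definition nequiv (A B : NObj) : relation (NHom A B) :=
  clos_refl_sym_trans (NHom A B) (@nle A B).

Definition reflects_ids (A : NObj) : Prop :=
  forall i j : 'I_(len A).+1, forall (h : i <= j), is_id (Xm h) -> i = j.

Definition DownStar : CatData :=
  @Build_CatData NObj NHom nequiv nid ncomp.

(* Down(C): quotient of the full subcategory \int N^{--,+}_+(C) *)
Definition Down : CatData :=
  @Build_CatData {A : NObj | reflects_ids A}
    (fun A B => NHom (sval A) (sval B))
    (fun A B => @nequiv (sval A) (sval B))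
    (fun A => nid (sval A)) (fun A B D => @ncomp (sval A) (sval B) (sval D)).

Definition DownIncl : Functor Down DownStar :=
  @Build_Functor Down DownStar (fun A => sval A) (fun A B f => f)
    (fun A B f g h => h)
    (fun A => rst_refl _ _ _)
    (fun A B D f g => rst_refl _ _ _).

End IntN.

(* Main.v *)
(** If [X(i <= j)] is an identity for some [i < j], then, since [X] takes
    values in [C_-] and a Reedy category has no non-identity loops in [C_-]
    (they would give a cycle for the well-founded relation [<']), already
    [X(i <= i+1)] is an identity. Deleting the object [i] along the coface
    [delta_i] then gives an isomorphic object of [Down_*(C)]: the
    codegeneracy [sigma_i] satisfies [sigma_i delta_i = id] and
    [id <= delta_i sigma_i], and its components [X(k <= delta_i sigma_i k)]
    are identities, hence in [C_+]. By induction on the length, every object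
    of [Down_*(C)] is isomorphic to one reflecting identities, and a full
    subcategory meeting every isomorphism class is equivalent to the ambient
    category. *)
Require Import Defs.
From mathcomp Require Import all_boot zify.
From Stdlib Require Import Relation_Definitions Relation_Operators.
From Stdlib Require Import Classical ClassicalEpsilon Morphisms.

Set Implicit Arguments.
Unset Strict Implicit.
Unset Printing Implicit Defensive.

Record CategoryLaws (D : CatData) : Prop := {
  cheq_equivalence : forall a b, Equivalence (@cheq D a b);
  ccomp_proper : forall a b c, Proper (cheq ==> cheq ==> cheq) (@ccomp D a b c);
  ccompA : forall a b c d (f : chom D a b) (g : chom D b c) (h : chom D c d),
      cheq (ccomp h (ccomp g f)) (ccomp (ccomp h g) f);
  ccomp1l : forall a b (f : chom D a b), cheq (ccomp (cid b) f) f;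
  ccomp1r : forall a b (f : chom D a b), cheq (ccomp f (cid a)) f
}.

Record Iso (D : CatData) (a b : D) := {
  iso_fw : chom D a b;
  iso_bw : chom D b a;
  iso_fwK : cheq (ccomp iso_bw iso_fw) (cid a);
  iso_bwK : cheq (ccomp iso_fw iso_bw) (cid b)
}.

Section FullSubcategory.
Variables (D : CatData) (P : D -> Prop).

Definition full_sub : CatData :=
  @Build_CatData {a : D | P a} (fun a b => chom D (sval a) (sval b))
    (fun a b => @cheq D (sval a) (sval b))
    (fun a => cid (sval a)) (fun a b c => @ccomp D (sval a) (sval b) (sval c)).

Hypothesis laws : CategoryLaws D.

#[local] Instance cheq_Equivalence a b : Equivalence (@cheq D a b) :=
  @cheq_equivalence D laws a b.
#[local] Instance ccomp_Proper a b c :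
  Proper (cheq ==> cheq ==> cheq) (@ccomp D a b c) := @ccomp_proper D laws a b c.

#[local] Hint Extern 0 (cheq _ _) => reflexivity : core.

Let compA a b c d := @ccompA D laws a b c d.
Let comp1l a b := @ccomp1l D laws a b.
Let comp1r a b := @ccomp1r D laws a b.
Arguments compA {a b c d}.
Arguments comp1l {a b}.
Arguments comp1r {a b}.

Definition full_incl : Functor full_sub D :=
  @Build_Functor full_sub D (fun a => sval a) (fun a b f => f)
    (fun a b f g e => e) (fun a => reflexivity _) (fun a b c f g => reflexivity _).

Lemma iso_refl (a : D) : Iso a a.
Proof. by exists (cid a) (cid a); apply: comp1l. Qed.

Lemma iso_trans (a b c : D) : Iso a b -> Iso b c -> Iso a c.
Proof.
move=> [f g gf fg] [f' g' gf' fg'].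
exists (ccomp f' f) (ccomp g g').
- by rewrite -compA (compA f) gf' comp1l.
- by rewrite -compA (compA g') fg comp1l.
Qed.

Hypothesis ess_surj : forall a : D, inhabited {b : full_sub & Iso a (sval b)}.

Let iso_to_sub (a : D) : {b : full_sub & Iso a (sval b)} :=
  epsilon (ess_surj a) (fun _ => True).
Let rep (a : D) : full_sub := projT1 (iso_to_sub a).
Let to_rep (a : D) : chom D a (sval (rep a)) := iso_fw (projT2 (iso_to_sub a)).
Let from_rep (a : D) : chom D (sval (rep a)) a := iso_bw (projT2 (iso_to_sub a)).
Let to_repK (a : D) : cheq (ccomp (from_rep a) (to_rep a)) (cid a) := iso_fwK _.
Let from_repK (a : D) : cheq (ccomp (to_rep a) (from_rep a)) (cid _) := iso_bwK _.

Let rep_hom (a b : D) (f : chom D a b) : chom D (sval (rep a)) (sval (rep b)) :=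
  ccomp (to_rep b) (ccomp f (from_rep a)).

Lemma rep_hom_id (a : D) : cheq (rep_hom (cid a)) (cid _).
Proof. by rewrite /rep_hom comp1l from_repK. Qed.

Lemma rep_hom_comp (a b c : D) (f : chom D a b) (g : chom D b c) :
  cheq (rep_hom (ccomp g f)) (ccomp (rep_hom g) (rep_hom f)).
Proof.
by rewrite /rep_hom !compA -(compA (to_rep b)) to_repK comp1r.
Qed.

Definition rep_functor : Functor D full_sub :=
  @Build_Functor D full_sub rep rep_hom
    (fun a b f g e => ccomp_Proper (reflexivity _) (ccomp_Proper e (reflexivity _)))
    rep_hom_id
    rep_hom_comp.

Lemma full_incl_equivalence : is_equivalence full_incl.
Proof.
exists rep_functor, (fun a => to_rep (sval a)), (fun a => from_rep (sval a)),
  from_rep, to_rep.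
split; split => /=.
- by move=> a; apply: to_repK.
- by move=> a; apply: from_repK.
- by move=> a b f; rewrite /rep_hom !compA -(compA (to_rep _)) to_repK comp1r.
- by move=> d; apply: from_repK.
- by move=> d; apply: to_repK.
- by move=> d e g; rewrite /rep_hom !compA to_repK comp1l.
Qed.

End FullSubcategory.

Lemma clos_rst_map (T U : Type) (RT : relation T) (RU : relation U) (f : T -> U) :
  (forall x y, RT x y -> RU (f x) (f y)) ->
  forall x y, clos_refl_sym_trans T RT x y -> clos_refl_sym_trans U RU (f x) (f y).
Proof.
move=> Rf x y; elim=> [{}x {}y /Rf|{}x|{}x {}y _|{}x {}y z _ Rxy _ Ryz].
- exact: rst_step.
- exact: rst_refl.
- exact: rst_sym.
- exact: rst_trans Rxy Ryz.
Qed.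

Lemma wf_asym (T : Type) (RT : relation T) :
  well_founded RT -> forall x y, RT x y -> RT y x -> False.
Proof.
move=> wf x; elim: x / (wf x) => x _ IH y xy yx.
exact: (IH y yx x yx xy).
Qed.

Section DownStarCategory.
Variables (C : Category) (R : Reedy C).

Lemma Xm_irr (A : NObj R) (i j : 'I_(len A).+1) (h h' : i <= j) :
  Xm (n := A) h = Xm h'.
Proof. by rewrite (bool_irrelevance h h'). Qed.

Lemma nle_ncompl (A B D : NObj R) (g : NHom B D) (f f' : NHom A B) :
  nle f f' -> nle (ncomp g f) (ncomp g f').
Proof.
case=> le_al le_th; split => /= [i|i h]; first exact: al_mono.
rewrite (le_th i (le_al i)) cmp_assoc -th_nat -cmp_assoc.
by rewrite (Xm_irr (al_mono g (le_al i)) h).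
Qed.

Lemma nle_ncompr (A B D : NObj R) (f : NHom A B) (g g' : NHom B D) :
  nle g g' -> nle (ncomp g f) (ncomp g' f).
Proof.
by case=> le_al le_th; split => /= [i|i h]; rewrite ?(le_th _ h) ?cmp_assoc.
Qed.

Lemma DownStar_laws : CategoryLaws (DownStar R).
Proof.
split => /=.
- by move=> A B; split; [exact: rst_refl | exact: rst_sym | exact: rst_trans].
- move=> A B D g g' gg' f f' ff'.
  apply: (rst_trans _ _ _ (ncomp g' f)).
  + exact: clos_rst_map (fun g => ncomp g f) (@nle_ncompr A B D f) _ _ gg'.
  + exact: clos_rst_map (ncomp g') (@nle_ncompl A B D g') _ _ ff'.
- move=> A B D E f g h; apply: rst_step; split => //= i le_ii.
  by rewrite Xm_id cmp_id_l cmp_assoc.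
- move=> A B f; apply: rst_step; split => //= i le_ii.
  by rewrite Xm_id !cmp_id_l.
- move=> A B f; apply: rst_step; split => //= i le_ii.
  by rewrite Xm_id cmp_id_l cmp_id_r.
Qed.

End DownStarCategory.

Section Reduction.
Variables (C : Category) (R : Reedy C).

Lemma is_id_plus (a b : C) (f : Hom C a b) : is_id f -> plus R f.
Proof. by case=> e <-; subst b; apply: plus_id. Qed.

Lemma Xm_eq_is_id (A : NObj R) (i j : 'I_(len A).+1) (h : i <= j) :
  i = j -> is_id (Xm h).
Proof. by move=> eq_ij; subst j; rewrite Xm_id; exists erefl. Qed.

Lemma minus_cmp_is_id (a b c : C) (f : Hom C a b) (g : Hom C b c) :
  minus R f -> minus R g -> is_id (cmp g f) -> is_id f.
Proof.
move=> mf mg [e]; subst c => /= id_gf.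
have [//|not_id_f] := classic (is_id f).
have [[e' id_g]|not_id_g] := classic (is_id g).
  by subst b; move: id_gf; rewrite -id_g /= cmp_id_l => <-; exists erefl.
exfalso; apply: (wf_asym (reedy_wf R) (x := a) (y := b)).
- by right; exists g.
- by right; exists f.
Qed.

Lemma Xm_is_id_le (A : NObj R) (i j k : 'I_(len A).+1)
    (le_ik : i <= k) (le_kj : k <= j) (le_ij : i <= j) :
  is_id (Xm le_ij) -> is_id (Xm le_ik).
Proof.
rewrite (Xm_comp le_ik le_kj le_ij).
by apply: minus_cmp_is_id; apply: Xm_minus.
Qed.

Section Face.
Variables (A : NObj R) (p : nat).
Hypothesis lt_p_len : p < len A.

Definition coface (i : 'I_(len A).-1.+1) : 'I_(len A).+1 :=
  inord (if i < p then i : nat else i.+1).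

Definition codegeneracy (i : 'I_(len A).+1) : 'I_(len A).-1.+1 :=
  inord (if i <= p then i : nat else i.-1).

Lemma coface_val i : coface i = (if i < p then i : nat else i.+1) :> nat.
Proof. have hi := ltn_ord i; rewrite inordK //; case: ifP => ?; lia. Qed.

Lemma codegeneracy_val i :
  codegeneracy i = (if i <= p then i : nat else i.-1) :> nat.
Proof. have hi := ltn_ord i; rewrite inordK //; case: ifP => ?; lia. Qed.

Lemma coface_mono (i j : 'I_(len A).-1.+1) : i <= j -> coface i <= coface j.
Proof. by rewrite !coface_val; case: ifP; case: ifP; lia. Qed.

Lemma codegeneracy_mono (i j : 'I_(len A).+1) :
  i <= j -> codegeneracy i <= codegeneracy j.
Proof. by rewrite !codegeneracy_val; case: ifP; case: ifP; lia. Qed.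

Lemma codegeneracyK : cancel coface codegeneracy.
Proof.
move=> i; apply: val_inj.
by rewrite /= codegeneracy_val coface_val; case: ifP; case: ifP; lia.
Qed.

Lemma le_coface_codegeneracy (i : 'I_(len A).+1) : i <= coface (codegeneracy i).
Proof. by rewrite coface_val codegeneracy_val; case: ifP; case: ifP; lia. Qed.

Lemma coface_codegeneracy_neq (i : 'I_(len A).+1) :
  i != p :> nat -> coface (codegeneracy i) = i.
Proof.
by move=> ne_ip; apply: val_inj; rewrite /= coface_val codegeneracy_val;
  move: ne_ip; case: ifP; case: ifP; lia.
Qed.

Definition face : NObj R :=
  @Build_NObj C R (len A).-1 (fun i => X (n := A) (coface i))
    (fun i j h => Xm (n := A) (coface_mono h))
    (fun i h => Xm_id _)
    (fun i j k h1 h2 h3 => Xm_comp _ _ _)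
    (fun i j h => Xm_minus _).

Lemma coface_nat (i j : 'I_(len face).+1) (h : i <= j) :
  cmp (Xm (n := A) (coface_mono h)) (idc _) = cmp (idc _) (Xm (n := face) h).
Proof. by rewrite cmp_id_l cmp_id_r. Qed.

Definition coface_hom : NHom face A :=
  @Build_NHom C R face A coface coface_mono (fun i => idc _)
    (fun i => plus_id R _) coface_nat.

Hypothesis Xm_p_is_id : forall (i j : 'I_(len A).+1) (h : i <= j),
  i = p :> nat -> j = p.+1 :> nat -> is_id (Xm h).

Lemma Xm_le_coface_codegeneracy_is_id (i : 'I_(len A).+1) :
  is_id (Xm (n := A) (le_coface_codegeneracy i)).
Proof.
have [eq_ip|ne_ip] := eqVneq (i : nat) p.
  by apply: Xm_p_is_id; rewrite // coface_val codegeneracy_val eq_ip leqnn ltnn.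
by apply: Xm_eq_is_id; rewrite coface_codegeneracy_neq.
Qed.

Lemma codegeneracy_nat (i j : 'I_(len A).+1) (h : i <= j) :
  cmp (Xm (n := face) (codegeneracy_mono h)) (Xm (le_coface_codegeneracy i)) =
  cmp (Xm (le_coface_codegeneracy j)) (Xm h).
Proof. by rewrite /= -!(Xm_comp _ _ (leq_trans h (le_coface_codegeneracy j))). Qed.

Definition codegeneracy_hom : NHom A face :=
  @Build_NHom C R A face codegeneracy codegeneracy_mono
    (fun i => Xm (le_coface_codegeneracy i))
    (fun i => is_id_plus (Xm_le_coface_codegeneracy_is_id i)) codegeneracy_nat.

Lemma face_iso : @Iso (DownStar R) A face.
Proof.
exists codegeneracy_hom coface_hom; apply: rst_sym; apply: rst_step; split => /=.
- exact: le_coface_codegeneracy.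
- by move=> i h; rewrite cmp_id_l cmp_id_r; apply: Xm_irr.
- by move=> i; rewrite codegeneracyK.
- by move=> i h; rewrite !cmp_id_r; apply: Xm_irr.
Qed.

End Face.

Lemma iso_shorter (A : NObj R) : ~ reflects_ids A ->
  exists2 B : NObj R, len B < len A & inhabited (@Iso (DownStar R) A B).
Proof.
move=> not_refl_A.
have [i [j [le_ij [id_ij ne_ij]]]] :
    exists (i j : 'I_(len A).+1) (le_ij : i <= j), is_id (Xm le_ij) /\ i <> j.
  apply: NNPP => none; apply: not_refl_A => i j le_ij id_ij.
  by apply: NNPP => ne_ij; apply: none; exists i, j, le_ij.
have lt_ij : i < j by rewrite ltn_neqAle le_ij andbT; apply/eqP => /val_inj.
have lt_i_len : i < len A by have := ltn_ord j; lia.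
have Xm_i_is_id (i' j' : 'I_(len A).+1) (h : i' <= j') :
    i' = i :> nat -> j' = i.+1 :> nat -> is_id (Xm h).
  move=> /val_inj eq_i' val_j'; subst i'.
  by apply: Xm_is_id_le id_ij; rewrite val_j'.
exists (face lt_i_len); first by rewrite /=; lia.
by constructor; apply: face_iso Xm_i_is_id.
Qed.

Lemma iso_reflects_ids (A : NObj R) :
  inhabited {B : @full_sub (DownStar R) (@reflects_ids C R) &
             @Iso (DownStar R) A (sval B)}.
Proof.
have [n lt_len] := ubnP (len A); elim: n A lt_len => // n IH A lt_len.
have [refl_A|not_refl_A] := classic (reflects_ids A).
  by constructor; exists (exist _ A refl_A); apply: iso_refl (DownStar_laws R) A.
have [B lt_len_B [iso_AB]] := iso_shorter not_refl_A.
have [[B' iso_BB']] := IH B (leq_trans lt_len_B lt_len).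
by constructor; exists B'; apply: iso_trans (DownStar_laws R) _ _ _ iso_AB iso_BB'.
Qed.

End Reduction.

Theorem lemma6p2 (C : Category) (R : Reedy C) :
  is_equivalence (DownIncl R).
Proof. exact: full_incl_equivalence (DownStar_laws R) (@iso_reflects_ids C R). Qed.
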